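(* Consider the complex 3-dimensional Novikov algebras $E_{1,\lambda}(\alpha)$ $(\lambda\in\mathbb{C}\setminus\{0,1\},\ \alpha\in\mathbb{C})$, $E_{2,\lambda}$ $(\lambda\in\mathbb{C}\setminus\{0,1\})$, $E_3$, $E_4$, $E_5(\beta)$ $(\beta\in\mathbb{C})$, $E_6$ and $B_1$, $B_2$, $B_3$, $B_4(\alpha)$ $(\alpha\in\mathbb{C})$, $B_5(\beta)$ $(\beta\in\mathbb{C})$ given by the products listed in the context. For $A$ in the first list (type $E_\lambda$, $\lambda\ne0,1$) and $B$ in the second list (type $B$), $B$ lies in $\partial O(A)$ if and only if $B$ is isomorphic to one of the algebras given for $A$ below, where $\lambda\in\mathbb{C}\setminus\{0,1\}$: \begin{itemize} \item $A=E_{1,\lambda}(\alpha)$ with $\alpha\neq-1,-\lambda$: $B_4(0)$, $B_5(0)$; \item $A=E_{1,\lambda}(-1)$: $B_5(0)$; \item $A=E_{1,\lambda}(-\lambda)\cong E_{1,1/\lambda}(-1)$: $B_5(0)$; \item $A=E_{2,\lambda}$: $B_4(0)$, $B_5(0)$; \item $A=E_3$: $B_3$, $B_4(\mu)$ for all $\mu\in\mathbb{C}$, $B_5(\nu)$ for all $\nu\in\mathbb{C}$; \item $A=E_4$: $B_3$, $B_4(\mu)$ for all $\mu\in\mathbb{C}$, $B_5(\nu)$ for all $\nu\in\mathbb{C}$; \item $A=E_5(\beta)$ with $\beta\neq-\tfrac12,-1$: $B_3$, $B_4(\mu)$ for all $\mu\in\mathbb{C}$, $B_5(\nu)$ for all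 $\nu\in\mathbb{C}$; \item $A=E_5(-\tfrac12)$: $B_3$, $B_5(\nu)$ for all $\nu\in\mathbb{C}$; \item $A=E_5(-1)$: $B_4(1)$, $B_5(0)$; \item $A=E_6$: $B_3$, $B_5(\nu)$ for all $\nu\in\mathbb{C}$. \end{itemize}
   Context: A Novikov algebra over $\mathbb{C}$ is a complex vector space with a bilinear product satisfying $(x\cdot y)\cdot z-x\cdot(y\cdot z)=(y\cdot x)\cdot z-y\cdot(x\cdot z)$ and $(x\cdot y)\cdot z=(x\cdot z)\cdot y$ for all $x,y,z$. Fix a 3-dimensional complex vector space $V$ with basis $(e_1,e_2,e_3)$. The set of Novikov products on $V$, identified with their structure constants in $\mathbb{C}^{27}$, is an affine algebraic set, on which $GL_3(\mathbb{C})$ acts by $(g\circ\mu)(x,y)=g(\mu(g^{-1}x,g^{-1}y))$. For a 3-dimensional Novikov algebra $A$, $O(A)$ is the orbit of a structure representing $A$, $\overline{O(A)}$ its Zariski closure, and $\partial O(A)=\overline{O(A)}\setminus O(A)$; ''$B$ lies in $\partial O(A)$'' means that a structure representing $B$ lies in $\partial O(A)$. The algebras (basis $e_1,e_2,e_3$; products of basis vectors not listed are zero): $E_{1,\lambda}(\alpha)$: $e_1e_1=\alpha e_1$, $e_1e_2=(\alpha+1)e_2$, $e_1e_3=(\alpha+\lambda)e_3$, $e_2e_1=\alpha e_2$, $e_3e_1=\alpha e_3$. $E_{2,\lambda}$: $e_1e_1=-e_1+e_2$, $e_1e_3=(\lambda-1)e_3$, $e_2e_1=-e_2$, $e_3e_1=-e_3$.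 $E_3$: $e_1e_1=-\frac12e_1+e_3$, $e_1e_2=\frac12e_2$, $e_1e_3=e_2$, $e_2e_1=-\frac12e_2$, $e_3e_1=e_2-\frac12e_3$. $E_4$: $e_1e_1=-e_1+e_2$, $e_1e_3=-\frac12e_3$, $e_2e_1=-e_2$, $e_3e_1=-e_3$, $e_3e_3=e_2$. $E_5(\beta)$: $e_1e_1=\beta e_1$, $e_1e_2=(\beta+1)e_2$, $e_1e_3=(\beta+\frac12)e_3$, $e_2e_1=\beta e_2$, $e_3e_1=\beta e_3$, $e_3e_3=e_2$. $E_6$: $e_1e_1=-\frac12e_1$, $e_1e_2=\frac12e_2$, $e_1e_3=e_2$, $e_2e_1=-\frac12e_2$, $e_3e_1=e_2-\frac12e_3$. $B_1$: $e_1e_1=e_1$, $e_1e_2=e_2+e_3$, $e_1e_3=e_3$, $e_2e_1=e_2$, $e_3e_1=e_3$. $B_2$: $e_1e_1=e_1$, $e_1e_2=e_2+e_3$, $e_1e_3=e_3$, $e_2e_1=e_2$, $e_2e_2=e_3$, $e_3e_1=e_3$. $B_3$: $e_1e_2=\frac12e_3$, $e_2e_1=-\frac12e_3$, $e_2e_2=e_3$. $B_4(\alpha)$: $e_1e_2=\alpha e_3$, $e_2e_1=(\alpha-1)e_3$, $e_2e_2=e_1$. $B_5(\beta)$: $e_1e_2=\beta e_3$, $e_2e_1=(\beta-1)e_3$. The only isomorphisms among these algebras are $B_5(\beta)\cong B_5(1-\beta)$ and $E_{1,\lambda}(\alpha)\cong E_{1,1/\lambda}(\alpha/\lambda)$.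 *)

(* Defs.v *)
From HB Require Import structures.
From mathcomp Require Import all_boot all_order all_algebra.
From mathcomp Require Import mpoly ring.

Set Implicit Arguments.
Unset Strict Implicit.
Unset Printing Implicit Defensive.

Import GRing.Theory.
Local Open Scope ring_scope.

(* A bilinear product mu on K^3 is given by its 27 structure constants: the   *)
(* value of mu at (i, j, k) is the coefficient of e_k in e_i e_j. Vectors are *)
(* column vectors, on which GL_3(K) acts by left multiplication.              *)
Definition structure (K : fieldType) := {ffun 'I_3 * 'I_3 * 'I_3 -> K}.

Definition basis_vec (K : fieldType) (i : 'I_3) : 'cV[K]_3 := delta_mx i 0.

Definition product (K : fieldType) (mu : structure K) (x y : 'cV[K]_3) :
    'cV[K]_3 :=
  \col_k \sum_i \sum_j x i 0 * y j 0 * mu (i, j, k).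

Definition structure_of (K : fieldType)
    (m : 'cV[K]_3 -> 'cV[K]_3 -> 'cV[K]_3) : structure K :=
  [ffun t => m (basis_vec K t.1.1) (basis_vec K t.1.2) t.2 0].

Definition novikov (K : fieldType) (mu : structure K) : Prop :=
  let m := product mu in
  (forall x y z, m (m x y) z - m x (m y z) = m (m y x) z - m y (m x z)) /\
  (forall x y z, m (m x y) z = m (m x z) y).

Definition act (K : fieldType) (g : 'M[K]_3) (mu : structure K) :
    structure K :=
  structure_of (fun x y =>
    g *m product mu (invmx g *m x) (invmx g *m y)).

Definition orbit (K : fieldType) (mu nu : structure K) : Prop :=
  exists2 g : 'M[K]_3, g \in unitmx & nu = act g mu.

Definition isomorphic (K : fieldType) (mu nu : structure K) : Prop :=
  exists2 g : 'M[K]_3, g \in unitmx &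
    forall x y, g *m product mu x y = product nu (g *m x) (g *m y).

Definition coords (K : fieldType) (mu : structure K) :
    'I_#|{: 'I_3 * 'I_3 * 'I_3}| -> K :=
  fun n => mu (enum_val n).

(* The closure is taken in the variety of Novikov products, with its subspace *)
(* topology; that variety being closed, this is the closure in K^27 when S    *)
(* consists of Novikov products.                                              *)
Definition zariski_closure (K : fieldType) (S : structure K -> Prop)
    (mu : structure K) : Prop :=
  novikov mu /\
  forall p : {mpoly K[#|{: 'I_3 * 'I_3 * 'I_3}|]},
    (forall nu, S nu -> p.@[coords nu] = 0) -> p.@[coords mu] = 0.

Definition orbit_boundary (K : fieldType) (A nu : structure K) : Prop :=
  zariski_closure (orbit A) nu /\ ~ orbit A nu.

Definition in_boundary (K : fieldType) (A B : structure K) : Prop :=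
  exists2 nu : structure K, isomorphic B nu & orbit_boundary A nu.

(* Row i, column j of the table t is the product e_i e_j.                     *)
Definition of_table (K : fieldType) (t : seq (seq 'cV[K]_3)) : structure K :=
  [ffun u : 'I_3 * 'I_3 * 'I_3 => nth 0 (nth [::] t u.1.1) u.1.2 u.2 0].

Local Notation i0 := (@Ordinal 3 0 isT).
Local Notation i1 := (@Ordinal 3 1 isT).
Local Notation i2 := (@Ordinal 3 2 isT).

Local Notation e1 := (basis_vec _ i0).
Local Notation e2 := (basis_vec _ i1).
Local Notation e3 := (basis_vec _ i2).

Definition E1 (K : fieldType) (lambda alpha : K) : structure K := of_table
  [:: [:: alpha *: e1; (alpha + 1) *: e2; (alpha + lambda) *: e3];
      [:: alpha *: e2; 0; 0];
      [:: alpha *: e3; 0; 0]].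

Definition E2 (K : fieldType) (lambda : K) : structure K := of_table
  [:: [:: - e1 + e2; 0; (lambda - 1) *: e3];
      [:: - e2; 0; 0];
      [:: - e3; 0; 0]].

Definition E3 (K : fieldType) : structure K := of_table
  [:: [:: - 2^-1 *: e1 + e3; 2^-1 *: e2; e2];
      [:: - 2^-1 *: e2; 0; 0];
      [:: e2 - 2^-1 *: e3; 0; 0]].

Definition E4 (K : fieldType) : structure K := of_table
  [:: [:: - e1 + e2; 0; - 2^-1 *: e3];
      [:: - e2; 0; 0];
      [:: - e3; 0; e2]].

Definition E5 (K : fieldType) (beta : K) : structure K := of_table
  [:: [:: beta *: e1; (beta + 1) *: e2; (beta + 2^-1) *: e3];
      [:: beta *: e2; 0; 0];
      [:: beta *: e3; 0; e2]].

Definition E6 (K : fieldType) : structure K := of_table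
  [:: [:: - 2^-1 *: e1; 2^-1 *: e2; e2];
      [:: - 2^-1 *: e2; 0; 0];
      [:: e2 - 2^-1 *: e3; 0; 0]].

Definition B1 (K : fieldType) : structure K := of_table
  [:: [:: e1; e2 + e3; e3];
      [:: e2; 0; 0];
      [:: e3; 0; 0]].

Definition B2 (K : fieldType) : structure K := of_table
  [:: [:: e1; e2 + e3; e3];
      [:: e2; e3; 0];
      [:: e3; 0; 0]].

Definition B3 (K : fieldType) : structure K := of_table
  [:: [:: 0; 2^-1 *: e3; 0];
      [:: - 2^-1 *: e3; e3; 0];
      [:: 0; 0; 0]].

Definition B4 (K : fieldType) (alpha : K) : structure K := of_table
  [:: [:: 0; alpha *: e3; 0];
      [:: (alpha - 1) *: e3; e1; 0];
      [:: 0; 0; 0]].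

Definition B5 (K : fieldType) (beta : K) : structure K := of_table
  [:: [:: 0; beta *: e3; 0];
      [:: (beta - 1) *: e3; 0; 0];
      [:: 0; 0; 0]].

Arguments E3 {K}.
Arguments E4 {K}.
Arguments E6 {K}.
Arguments B1 {K}.
Arguments B2 {K}.
Arguments B3 {K}.

Inductive type_B (K : fieldType) : structure K -> Prop :=
  | type_B1 : type_B B1
  | type_B2 : type_B B2
  | type_B3 : type_B B3
  | type_B4 alpha : type_B (B4 alpha)
  | type_B5 beta : type_B (B5 beta).

(* The structures of type B that lie in the boundary of the orbit of A are    *)
(* exactly those isomorphic to a member of L.                                 *)
Definition type_B_boundary (K : fieldType) (A : structure K)
    (L : structure K -> Prop) : Prop :=
  forall B, type_B B ->
    (in_boundary A B <-> exists2 B', L B' & isomorphic B B').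

Lemma productE (K : fieldType) (mu : structure K) x y k :
  product mu x y k 0 = \sum_i \sum_j x i 0 * y j 0 * mu (i, j, k).
Proof. by rewrite mxE. Qed.

Lemma cV_subE (K : fieldType) (u v : 'cV[K]_3) l : (u - v) l 0 = u l 0 - v l 0.
Proof. by rewrite !mxE. Qed.

Lemma product_of_table (K : fieldType)
    (a00 a01 a02 a10 a11 a12 a20 a21 a22 : 'cV[K]_3) x y :
  product (of_table [:: [:: a00; a01; a02];
                        [:: a10; a11; a12];
                        [:: a20; a21; a22]]) x y =
  (x i0 0 * y i0 0) *: a00 + (x i0 0 * y i1 0) *: a01 +
  (x i0 0 * y i2 0) *: a02 + (x i1 0 * y i0 0) *: a10 +
  (x i1 0 * y i1 0) *: a11 + (x i1 0 * y i2 0) *: a12 +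
  (x i2 0 * y i0 0) *: a20 + (x i2 0 * y i1 0) *: a21 +
  (x i2 0 * y i2 0) *: a22.
Proof.
have l0 : lift ord0 ord0 = i1 by apply: val_inj.
have l1 : lift ord0 (lift ord0 ord0) = i2 by apply: val_inj.
have o0 : ord0 = i0 by apply: val_inj.
apply/colP=> k; rewrite productE !big_ord_recl !big_ord0 !ffunE /= !mxE.
by rewrite l1 l0 o0 !addr0 !addrA.
Qed.

Ltac table_tac := rewrite product_of_table !mxE !eqE /=; field.

Lemma ord3_ind (P : 'I_3 -> Prop) : P i0 -> P i1 -> P i2 -> forall i, P i.
Proof.
move=> P0 P1 P2 [[|[|[|//]]] i3].
- by rewrite (bool_irrelevance i3 isT).
- by rewrite (bool_irrelevance i3 isT).
- by rewrite (bool_irrelevance i3 isT).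
Qed.

Ltac novikov_tac p0 p1 p2 :=
  split=> x y z; apply/colP; apply: ord3_ind;
  rewrite ?cV_subE ?(p0, p1, p2); field.

Lemma novikov_E1 (K : fieldType) (l a : K) : novikov (E1 l a).
Proof.
have p0 x y : product (E1 l a) x y i0 0 =
    a * x i0 0 * y i0 0
  by table_tac.
have p1 x y : product (E1 l a) x y i1 0 =
    (a + 1) * x i0 0 * y i1 0 + a * x i1 0 * y i0 0
  by table_tac.
have p2 x y : product (E1 l a) x y i2 0 =
    (a + l) * x i0 0 * y i2 0 + a * x i2 0 * y i0 0
  by table_tac.
by novikov_tac p0 p1 p2.
Qed.

Lemma novikov_E2 (K : fieldType) (l : K) : novikov (E2 l).
Proof.
have p0 x y : product (E2 l) x y i0 0 =
    -1 * x i0 0 * y i0 0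
  by table_tac.
have p1 x y : product (E2 l) x y i1 0 =
    x i0 0 * y i0 0 - x i1 0 * y i0 0
  by table_tac.
have p2 x y : product (E2 l) x y i2 0 =
    (l - 1) * x i0 0 * y i2 0 - x i2 0 * y i0 0
  by table_tac.
by novikov_tac p0 p1 p2.
Qed.

Lemma novikov_E3 (K : fieldType) : 2 != 0 :> K -> novikov (@E3 K).
Proof.
move=> K2.
have p0 x y : product (@E3 K) x y i0 0 =
    - 2^-1 * x i0 0 * y i0 0
  by table_tac.
have p1 x y : product (@E3 K) x y i1 0 =
    2^-1 * x i0 0 * y i1 0 + x i0 0 * y i2 0
    - 2^-1 * x i1 0 * y i0 0 + x i2 0 * y i0 0
  by table_tac.
have p2 x y : product (@E3 K) x y i2 0 =
    x i0 0 * y i0 0 - 2^-1 * x i2 0 * y i0 0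
  by table_tac.
by novikov_tac p0 p1 p2.
Qed.

Lemma novikov_E4 (K : fieldType) : 2 != 0 :> K -> novikov (@E4 K).
Proof.
move=> K2.
have p0 x y : product (@E4 K) x y i0 0 =
    -1 * x i0 0 * y i0 0
  by table_tac.
have p1 x y : product (@E4 K) x y i1 0 =
    x i0 0 * y i0 0 - x i1 0 * y i0 0 + x i2 0 * y i2 0
  by table_tac.
have p2 x y : product (@E4 K) x y i2 0 =
    - 2^-1 * x i0 0 * y i2 0 - x i2 0 * y i0 0
  by table_tac.
by novikov_tac p0 p1 p2.
Qed.

Lemma novikov_E5 (K : fieldType) (b : K) : 2 != 0 :> K -> novikov (E5 b).
Proof.
move=> K2.
have p0 x y : product (E5 b) x y i0 0 =
    b * x i0 0 * y i0 0
  by table_tac.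
have p1 x y : product (E5 b) x y i1 0 =
    (b + 1) * x i0 0 * y i1 0 + b * x i1 0 * y i0 0 + x i2 0 * y i2 0
  by table_tac.
have p2 x y : product (E5 b) x y i2 0 =
    (b + 2^-1) * x i0 0 * y i2 0 + b * x i2 0 * y i0 0
  by table_tac.
by novikov_tac p0 p1 p2.
Qed.

Lemma novikov_E6 (K : fieldType) : 2 != 0 :> K -> novikov (@E6 K).
Proof.
move=> K2.
have p0 x y : product (@E6 K) x y i0 0 =
    - 2^-1 * x i0 0 * y i0 0
  by table_tac.
have p1 x y : product (@E6 K) x y i1 0 =
    2^-1 * x i0 0 * y i1 0 + x i0 0 * y i2 0
    - 2^-1 * x i1 0 * y i0 0 + x i2 0 * y i0 0
  by table_tac.
have p2 x y : product (@E6 K) x y i2 0 =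
    - 2^-1 * x i2 0 * y i0 0
  by table_tac.
by novikov_tac p0 p1 p2.
Qed.

Lemma novikov_B1 (K : fieldType) : novikov (@B1 K).
Proof.
have p0 x y : product (@B1 K) x y i0 0 =
    x i0 0 * y i0 0
  by table_tac.
have p1 x y : product (@B1 K) x y i1 0 =
    x i0 0 * y i1 0 + x i1 0 * y i0 0
  by table_tac.
have p2 x y : product (@B1 K) x y i2 0 =
    x i0 0 * y i1 0 + x i0 0 * y i2 0 + x i2 0 * y i0 0
  by table_tac.
by novikov_tac p0 p1 p2.
Qed.

Lemma novikov_B2 (K : fieldType) : novikov (@B2 K).
Proof.
have p0 x y : product (@B2 K) x y i0 0 =
    x i0 0 * y i0 0
  by table_tac.
have p1 x y : product (@B2 K) x y i1 0 =
    x i0 0 * y i1 0 + x i1 0 * y i0 0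
  by table_tac.
have p2 x y : product (@B2 K) x y i2 0 =
    x i0 0 * y i1 0 + x i0 0 * y i2 0 + x i2 0 * y i0 0 + x i1 0 * y i1 0
  by table_tac.
by novikov_tac p0 p1 p2.
Qed.

Lemma novikov_B3 (K : fieldType) : 2 != 0 :> K -> novikov (@B3 K).
Proof.
move=> K2.
have p0 x y : product (@B3 K) x y i0 0 =
    0
  by table_tac.
have p1 x y : product (@B3 K) x y i1 0 =
    0
  by table_tac.
have p2 x y : product (@B3 K) x y i2 0 =
    2^-1 * x i0 0 * y i1 0 - 2^-1 * x i1 0 * y i0 0 + x i1 0 * y i1 0
  by table_tac.
by novikov_tac p0 p1 p2.
Qed.

Lemma novikov_B4 (K : fieldType) (a : K) : novikov (B4 a).
Proof.
have p0 x y : product (B4 a) x y i0 0 =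
    x i1 0 * y i1 0
  by table_tac.
have p1 x y : product (B4 a) x y i1 0 =
    0
  by table_tac.
have p2 x y : product (B4 a) x y i2 0 =
    a * x i0 0 * y i1 0 + (a - 1) * x i1 0 * y i0 0
  by table_tac.
by novikov_tac p0 p1 p2.
Qed.

Lemma novikov_B5 (K : fieldType) (b : K) : novikov (B5 b).
Proof.
have p0 x y : product (B5 b) x y i0 0 =
    0
  by table_tac.
have p1 x y : product (B5 b) x y i1 0 =
    0
  by table_tac.
have p2 x y : product (B5 b) x y i2 0 =
    b * x i0 0 * y i1 0 + (b - 1) * x i1 0 * y i0 0
  by table_tac.
by novikov_tac p0 p1 p2.
Qed.

(* Main.v *)
Require Import Defs.
From mathcomp Require Import all_boot all_order all_algebra.
From mathcomp Require Import mpoly ring.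
From mathcomp Require Import reals complex.

Set Implicit Arguments.
Unset Strict Implicit.
Unset Printing Implicit Defensive.

Import GRing.Theory Num.Theory.
Local Open Scope ring_scope.

(** Every algebra A of the first list has the same shape.  Its commutator is
    the solvable Lie algebra r_{3,l}, in which ad e_1 has eigenvalues 0, 1 and
    l (with l = 1/2 from E_3 on), whereas each algebra of type B has the
    Heisenberg algebra as commutator: so no B is isomorphic to an A, and lying
    in the boundary of the orbit only means lying in its closure.

    Exclusion.  Zariski closures are cut out by polynomial identities in the
    structure constants, and two families of identities are enough.
    - On the orbit of A the cubic equation ad_x (ad_x - f)(ad_x - l f) = 0
      holds with f a linear form, and tr R_x = c f(x).  Clearing f gives
      c^2 ad_x^3 - (1 + l) c (tr R_x) ad_x^2 + l (tr R_x)^2 ad_x = 0.  In B_1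
      and B_2, ad_x squares to zero and is nonzero while tr R_x is not zero;
      since l is nonzero these two never occur ([closure_not_B12]).
    - Subtract from every right multiplication its scalar part: the bilinear
      map T(x, y) = xy - (tr R_y / 3) x commutes with the action of GL_3.  For
      E_1 and E_2 it factors as f(x) C(y), for E_5(-1) as f(y) C(x), for E_1
      with parameter -1 or -l in both ways, for E_5(-1/2) and E_6 as
      w(x, y) u.  Each factorisation makes a family of 2 x 2 minors vanish on
      the orbit, hence on its closure.  On the nilpotent algebras B_3, B_4, B_5
      all traces vanish, T is the product itself, and the minors leave exactly
      the parameters of the statement ([left_rank1_type_B],
      [right_rank1_type_B], [image_rank1_type_B]).

    Degeneration.  In a suitable basis each A takes the form [adapted_form].
    Weights (2, 1, 3) on that basis define a one-parameter subgroup t^w under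
    which, as t goes to 0, all terms but those of B_4(m) disappear; weights
    (3, 2, 5) leave only B_5(m) ([closure_initial_form]).  The basis exists for
    all but finitely many m when a whole family is reached, and the missing
    members, as well as B_3, are limits along a line ([closure_line]). *)

(** * Products and change of basis in coordinates *)

(* The orbit of a structure, not that of a point under iteration of a map. *)
Local Notation orbit := Defs.orbit.

Local Notation i0 := (@Ordinal 3 0 isT).
Local Notation i1 := (@Ordinal 3 1 isT).
Local Notation i2 := (@Ordinal 3 2 isT).

Local Notation e1 := (basis_vec _ i0).
Local Notation e2 := (basis_vec _ i1).
Local Notation e3 := (basis_vec _ i2).

Section Coordinates.
Variable K : fieldType.
Implicit Types (mu : structure K) (x y : 'cV[K]_3).

Lemma sum3E (F : 'I_3 -> K) : \sum_i F i = F i0 + F i1 + F i2.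
Proof.
rewrite !big_ord_recl big_ord0 addr0 addrA.
by congr (F _ + F _ + F _); apply: val_inj.
Qed.

Definition col3 (a b c : K) : 'cV[K]_3 := \col_i [:: a; b; c]`_i.

Lemma col3E a b c :
  (col3 a b c i0 0 = a) * (col3 a b c i1 0 = b) * (col3 a b c i2 0 = c).
Proof. by rewrite !mxE. Qed.

Definition mat3 (a b c d e f g h i : K) : 'M[K]_3 :=
  \matrix_(k, l) (nth [::] [:: [:: a; b; c]; [:: d; e; f]; [:: g; h; i]] k)`_l.

Lemma mul_mat3 a b c d e f g h i x :
  mat3 a b c d e f g h i *m x =
  col3 (a * x i0 0 + b * x i1 0 + c * x i2 0)
       (d * x i0 0 + e * x i1 0 + f * x i2 0)
       (g * x i0 0 + h * x i1 0 + i * x i2 0).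
Proof.
by apply/colP; apply: ord3_ind; rewrite mxE sum3E !mxE.
Qed.

(** The inverse is the adjugate divided by the determinant in the hypothesis. *)
Lemma unitmx_mat3 a b c d e f g h i :
  a * (e * i - f * h) - b * (d * i - f * g) + c * (d * h - e * g) != 0 ->
  mat3 a b c d e f g h i \in unitmx.
Proof.
set D := (X in X != 0) => D0.
pose adj := mat3 (e * i - f * h) (c * h - b * i) (b * f - c * e)
                 (f * g - d * i) (a * i - c * g) (c * d - a * f)
                 (d * h - e * g) (b * g - a * h) (a * e - b * d).
have /mulmx1_unit[] // : mat3 a b c d e f g h i *m (D^-1 *: adj) = 1%:M.
rewrite -scalemxAr; apply/matrixP => k l; rewrite mxE [X in _ * X]mxE sum3E.
by move: k l; apply: ord3_ind; apply: ord3_ind;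
   rewrite !mxE ?eqE /D /=; field.
Qed.

Lemma cV_scaleE c x k : (c *: x) k 0 = c * x k 0.
Proof. by rewrite mxE. Qed.

Lemma basis_vecE (i k : 'I_3) : basis_vec K i k 0 = (k == i)%:R.
Proof. by rewrite mxE eqxx andbT. Qed.

(** As matrices, so that bilinearity of the product becomes linearity of the
    matrix product. *)
Definition lmul mu x : 'M[K]_3 := \matrix_(k, j) \sum_i x i 0 * mu (i, j, k).
Definition rmul mu y : 'M[K]_3 := \matrix_(k, i) \sum_j y j 0 * mu (i, j, k).

Lemma product_rmul mu x y : product mu x y = rmul mu y *m x.
Proof.
apply/colP=> k; rewrite productE mxE; apply: eq_bigr => i _.
rewrite mxE mulr_suml; apply: eq_bigr => j _.
by rewrite -mulrA mulrC.
Qed.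

Lemma product_lmul mu x y : product mu x y = lmul mu x *m y.
Proof.
apply/colP=> k; rewrite productE mxE exchange_big; apply: eq_bigr => j _.
rewrite mxE mulr_suml; apply: eq_bigr => i _.
by rewrite mulrAC.
Qed.

Lemma cV_basis x : x = \sum_i x i 0 *: basis_vec K i.
Proof.
apply/colP=> k; rewrite summxE (bigD1 k) //= big1 ?addr0.
  by rewrite mxE basis_vecE eqxx mulr1.
by move=> i ik; rewrite mxE basis_vecE eq_sym (negPf ik) mulr0.
Qed.

Lemma product_basis mu i j k :
  product mu (basis_vec K i) (basis_vec K j) k 0 = mu (i, j, k).
Proof.
rewrite productE (bigD1 i) //= [X in _ + X]big1 ?addr0; last first.
  by move=> a ai; apply: big1 => b _; rewrite !basis_vecE (negPf ai) !mul0r.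
rewrite (bigD1 j) //= big1 ?addr0; last first.
  by move=> b bj; rewrite !basis_vecE (negPf bj) mulr0 mul0r.
by rewrite !basis_vecE !eqxx !mul1r.
Qed.

Lemma product_inj mu nu : (forall x y, product mu x y = product nu x y) ->
  mu = nu.
Proof.
by move=> E; apply/ffunP=> -[[i j] k]; rewrite -!product_basis E.
Qed.

(** The action is defined on structure constants, that is on basis vectors;
    bilinearity extends it to all vectors. *)
Lemma product_act (g : 'M[K]_3) mu x y :
  product (act g mu) x y = g *m product mu (invmx g *m x) (invmx g *m y).
Proof.
have -> : g *m product mu (invmx g *m x) (invmx g *m y) =
    \sum_i \sum_j (x i 0 * y j 0) *:
      (g *m product mu (invmx g *m basis_vec K i) (invmx g *m basis_vec K j)).
  rewrite {1}(cV_basis x) product_rmul !mulmx_sumr; apply: eq_bigr => i _.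
  rewrite -!scalemxAr -product_rmul {1}(cV_basis y) product_lmul !mulmx_sumr.
  rewrite scaler_sumr; apply: eq_bigr => j _.
  by rewrite -!scalemxAr -product_lmul scalerA.
apply/colP=> k; rewrite productE summxE; apply: eq_bigr => i _.
by rewrite summxE; apply: eq_bigr => j _; rewrite [RHS]mxE ffunE.
Qed.

Lemma orbit_isomorphic mu nu : orbit mu nu <-> isomorphic mu nu.
Proof.
split=> -[g gU E]; exists g => //.
  by move=> x y; rewrite E product_act !mulKmx.
by apply: product_inj => x y; rewrite product_act E !mulKVmx.
Qed.

Lemma isomorphic_refl mu : isomorphic mu mu.
Proof. by exists 1%:M; rewrite ?unitmx1 // => x y; rewrite !mul1mx. Qed.

Lemma isomorphic_sym mu nu : isomorphic mu nu -> isomorphic nu mu.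
Proof.
case=> g gU E; exists (invmx g); first by rewrite unitmx_inv.
by move=> x y; rewrite -{1}(mulKVmx gU x) -{1}(mulKVmx gU y) -E mulKmx.
Qed.

Lemma isomorphic_trans mu nu rho :
  isomorphic mu nu -> isomorphic nu rho -> isomorphic mu rho.
Proof.
case=> g gU E [h hU F]; exists (h *m g); first by rewrite unitmx_mul hU.
by move=> x y; rewrite -!mulmxA E F.
Qed.

Lemma novikov_act (g : 'M[K]_3) mu :
  g \in unitmx -> novikov mu -> novikov (act g mu).
Proof.
move=> gU [as_mu rc_mu]; split=> x y z; rewrite !product_act !mulKmx //.
  by rewrite -!mulmxBr as_mu.
by rewrite rc_mu.
Qed.

End Coordinates.

(** * Polynomial functions and the closure of an orbit *)

(** A function on [X] is represented when it is the evaluation of an element of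
    the ring [P].  The same closure properties serve twice: for functions of
    the 27 structure constants, and for functions of the parameter of a
    curve. *)
Section RepresentedFunctions.
Variables (K : fieldType) (X : Type) (P : comNzRingType).
Variables (ev : X -> {rmorphism P -> K}) (cst : K -> P).
Hypothesis ev_cst : forall x a, ev x (cst a) = a.
Implicit Types F G : X -> K.

Definition represented F := exists p, forall x, ev x p = F x.

Lemma represented_cst a : represented (fun=> a).
Proof. by exists (cst a) => x; rewrite ev_cst. Qed.

Lemma representedD F G :
  represented F -> represented G -> represented (fun x => F x + G x).
Proof. by case=> p pE [q qE]; exists (p + q) => x; rewrite rmorphD pE qE. Qed.

Lemma representedB F G :
  represented F -> represented G -> represented (fun x => F x - G x).
Proof. by case=> p pE [q qE]; exists (p - q) => x; rewrite rmorphB pE qE. Qed.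

Lemma representedM F G :
  represented F -> represented G -> represented (fun x => F x * G x).
Proof. by case=> p pE [q qE]; exists (p * q) => x; rewrite rmorphM pE qE. Qed.

Lemma representedX F n : represented F -> represented (fun x => F x ^+ n).
Proof. by case=> p pE; exists (p ^+ n) => x; rewrite rmorphXn pE. Qed.

Lemma represented_sum (I : Type) (r : seq I) (F : I -> X -> K) :
  (forall i, represented (F i)) -> represented (fun x => \sum_(i <- r) F i x).
Proof.
move=> repF; elim: r => [|i r [p pE]].
  by exists 0 => x; rewrite big_nil rmorph0.
by have [q qE] := repF i; exists (q + p) => x; rewrite big_cons rmorphD pE qE.
Qed.

Lemma represented_prod (I : Type) (r : seq I) (F : I -> X -> K) :
  (forall i, represented (F i)) -> represented (fun x => \prod_(i <- r) F i x).
Proof.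
move=> repF; elim: r => [|i r [p pE]].
  by exists 1 => x; rewrite big_nil rmorph1.
by have [q qE] := repF i; exists (q * p) => x; rewrite big_cons rmorphM pE qE.
Qed.

Lemma represented_ext F G : represented F -> F =1 G -> represented G.
Proof. by case=> p pE FG; exists p => x; rewrite pE FG. Qed.

(** Composing with a polynomial in the structure constants is again
    polynomial: it makes the group action pass to closures, and a curve lie in
    the closure as soon as most of its points do. *)
Lemma represented_meval (p : {mpoly K[#|{: 'I_3 * 'I_3 * 'I_3}|]})
    (c : X -> structure K) :
  (forall u, represented (fun x => c x u)) ->
  represented (fun x => p.@[coords (c x)]).
Proof.
move=> repc.
apply: (@represented_ext (fun x =>
  \sum_(m <- msupp p) p@_m * \prod_i coords (c x) i ^+ m i)); last first.
  by move=> x; rewrite mevalE.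
apply: represented_sum => m; apply: representedM; first exact: represented_cst.
by apply: represented_prod => i; apply: representedX; apply: repc.
Qed.

End RepresentedFunctions.

Section PolynomialFunctions.
Variable K : fieldType.
Implicit Types (mu : structure K) (F G : structure K -> K).

Definition ev_structure mu :
  {rmorphism {mpoly K[#|{: 'I_3 * 'I_3 * 'I_3}|]} -> K} := meval (coords mu).

Definition polyfun F := represented ev_structure F.

Lemma ev_structureC mu a : ev_structure mu a%:MP = a.
Proof. exact: mevalC. Qed.

Definition polyfun_cst := represented_cst ev_structureC.

Lemma polyfun_coord u : polyfun (fun mu => mu u).
Proof.
by exists 'X_(enum_rank u) => mu; rewrite /= mevalXU /coords enum_rankK.
Qed.

Lemma polyfun_product (X Y : structure K -> 'cV[K]_3) k :
  (forall i, polyfun (fun mu => X mu i 0)) ->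
  (forall i, polyfun (fun mu => Y mu i 0)) ->
  polyfun (fun mu => product mu (X mu) (Y mu) k 0).
Proof.
move=> polyX polyY; apply: (@represented_ext _ _ _ _
  (fun mu => \sum_i \sum_j X mu i 0 * Y mu j 0 * mu (i, j, k))).
  apply: represented_sum => i; apply: represented_sum => j.
  apply: representedM (polyfun_coord _).
  exact: representedM (polyX i) (polyY j).
by move=> mu; rewrite productE.
Qed.

Lemma polyfun_act (g : 'M[K]_3) u : polyfun (fun mu => act g mu u).
Proof.
case: u => [[i j] k]; apply: (@represented_ext _ _ _ _
  (fun mu => \sum_l g k l *
   product mu (invmx g *m basis_vec K i) (invmx g *m basis_vec K j) l 0)).
  apply: represented_sum => l; apply: representedM; first exact: polyfun_cst.
  by apply: polyfun_product => a; apply: polyfun_cst.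
by move=> mu; rewrite ffunE mxE.
Qed.

Variable S : structure K -> Prop.

Lemma closure_polyfun F mu : polyfun F -> (forall nu, S nu -> F nu = 0) ->
  zariski_closure S mu -> F mu = 0.
Proof.
by move=> [p pE] F0 [_ clS]; rewrite -pE; apply: clS => nu /F0; rewrite -pE.
Qed.

Lemma closure_act (g : 'M[K]_3) mu : g \in unitmx ->
  (forall nu, S nu -> S (act g nu)) ->
  zariski_closure S mu -> zariski_closure S (act g mu).
Proof.
move=> gU stabS clSmu; split; first by apply: novikov_act => //; case: clSmu.
move=> p p0; apply: (closure_polyfun (F := fun nu => _) _ _ clSmu).
  exact: (represented_meval ev_structureC _ (polyfun_act g)).
by move=> nu /stabS/p0.
Qed.

End PolynomialFunctions.

Section OrbitClosure.
Variables (K : fieldType) (A : structure K).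
Implicit Types mu nu : structure K.

Lemma closure_orbit mu : novikov mu -> isomorphic A mu ->
  zariski_closure (orbit A) mu.
Proof. by move=> nov_mu /orbit_isomorphic Amu; split=> // p; apply. Qed.

Lemma orbit_act (g : 'M[K]_3) nu : g \in unitmx ->
  orbit A nu -> orbit A (act g nu).
Proof.
move=> gU /orbit_isomorphic iso; apply/orbit_isomorphic.
by apply: isomorphic_trans iso _; apply/orbit_isomorphic; exists g.
Qed.

Lemma closure_isomorphic mu nu : isomorphic mu nu ->
  zariski_closure (orbit A) mu -> zariski_closure (orbit A) nu.
Proof.
case/orbit_isomorphic=> g gU ->; apply: closure_act => // rho.
exact: orbit_act.
Qed.

(** As the closure is a union of orbits, [B] itself may be taken as the
    structure that represents it. *)
Lemma in_boundaryE B :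
  in_boundary A B <-> zariski_closure (orbit A) B /\ ~ isomorphic A B.
Proof.
split=> [[nu Bnu [clnu Anu]]|[clB AB]].
  split; first exact: closure_isomorphic (isomorphic_sym Bnu) clnu.
  by move=> AB; apply/Anu/orbit_isomorphic/(isomorphic_trans AB Bnu).
exists B; first exact: isomorphic_refl.
by split=> // /orbit_isomorphic.
Qed.

End OrbitClosure.

(** * Degenerations along curves *)

Section Curves.
Variables (K : numFieldType) (S : structure K -> Prop).

Lemma poly_cofinite_eq0 (q : {poly K}) (bad : seq K) :
  (forall t, t \notin bad -> q.[t] = 0) -> q = 0.
Proof.
move=> q0; pose d := \prod_(z <- bad) ('X - z%:P).
suff /eqP : q * d = 0.
  rewrite mulf_eq0 => /orP[/eqP //|/eqP d0].
  by have := monic_neq0 (monic_prod_XsubC bad xpredT id); rewrite -/d d0 eqxx.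
have dq0 t : root (q * d) t.
  rewrite /root hornerM; have [tb|/q0->] := boolP (t \in bad); last first.
    by rewrite mul0r.
  have : root d t by rewrite root_prod_XsubC.
  by rewrite /root => /eqP->; rewrite mulr0.
apply/eqP/negPn/negP => qd0.
pose rs := [seq i%:R : K | i <- iota 0 (size (q * d))].
have := max_poly_roots (rs := rs) qd0; rewrite size_map size_iota ltnn.
move=> /(_ _ _)/negP; apply=> //.
  by apply/allP=> t _; apply: dq0.
by rewrite map_inj_uniq ?iota_uniq //; apply/mulrIn/oner_neq0.
Qed.

Definition polycurve (c : K -> structure K) :=
  forall u, represented
    (@horner_eval K : K -> {rmorphism _ -> _}) (fun t => c t u).

(** A polynomial vanishing on [S] restricts to a one-variable polynomial on the
    curve; having infinitely many roots it is zero, at [t0] too.  The list [bad]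
    leaves room for the parameters at which a change of basis breaks down. *)
Lemma closure_curve (c : K -> structure K) (bad : seq K) t0 :
  polycurve c ->
  (forall t, t \notin bad -> zariski_closure S (c t)) ->
  novikov (c t0) -> zariski_closure S (c t0).
Proof.
move=> poly_c clc nov; split=> // p p0.
have evC (t : K) a : horner_eval t a%:P = a by rewrite /horner_eval hornerC.
have [q qE] := represented_meval evC p poly_c.
rewrite -qE (@poly_cofinite_eq0 q bad) ?rmorph0 // => t /clc[_ /(_ p p0) <-].
exact: qE.
Qed.

Lemma closure_line mu nu (bad : seq K) t0 :
  (forall t, t \notin bad -> zariski_closure S [ffun u => mu u + t * nu u]) ->
  novikov [ffun u => mu u + t0 * nu u] ->
  zariski_closure S [ffun u => mu u + t0 * nu u].
Proof.
move=> cl nov.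
apply: (closure_curve (c := fun t => [ffun u => mu u + t * nu u]) _ cl nov).
move=> u; exists ((mu u)%:P + 'X * (nu u)%:P) => t.
by rewrite ffunE /= /horner_eval !hornerE.
Qed.

End Curves.

Section InitialForm.
Variables (K : numFieldType) (A : structure K) (w : 'I_3 -> nat).

(** Scaling the basis by t^w multiplies the constant at (i, j, k) by
    t^(w i + w j - w k), up to the inverse of t.  The exponents are nonnegative
    by hypothesis, so t can be set to 0, where only the constants of exponent 0
    survive. *)
Lemma closure_initial_form :
  (forall i j k, A (i, j, k) != 0 -> (w k <= w i + w j)%N) ->
  let B := [ffun u : 'I_3 * 'I_3 * 'I_3 =>
              if (w u.1.1 + w u.1.2 == w u.2)%N then A u else 0] in
  novikov A -> novikov B -> zariski_closure (orbit A) B.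
Proof.
move=> wA B novA novB; pose c (t : K) : structure K :=
  [ffun u => t ^+ (w u.1.1 + w u.1.2 - w u.2) * A u].
have c0 : c 0 = B.
  apply/ffunP=> -[[i j] k]; rewrite !ffunE /=.
  have [A0|/wA wA0] := eqVneq (A (i, j, k)) 0.
    by rewrite A0 mulr0 if_same.
  rewrite expr0n subn_eq0 eqn_leq wA0 andbT.
  by case: ifP; rewrite ?mul1r ?mul0r.
rewrite -c0; apply: (closure_curve (c := c) (bad := [:: 0])); last 1 first.
- by rewrite c0.
- move=> [[i j] k]; exists ('X^(w i + w j - w k) * (A (i, j, k))%:P) => t.
  by rewrite ffunE /= /horner_eval !hornerE.
move=> t; rewrite inE => t0.
have tnz n : t ^+ n != 0 by rewrite expf_neq0.
have iso : isomorphic A (c t).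
  apply: isomorphic_sym; exists (diag_mx (\row_i t ^+ w i)).
    rewrite unitmxE det_diag unitfE; apply/prodf_neq0 => i _.
    by rewrite mxE.
  move=> x y; apply/colP=> k; rewrite mul_diag_mx mxE !productE mulr_sumr.
  apply: eq_bigr => i _; rewrite mulr_sumr; apply: eq_bigr => j _.
  rewrite !mul_diag_mx !mxE ffunE /=.
  have [A0|/wA wA0] := eqVneq (A (i, j, k)) 0; first by rewrite A0 !mulr0.
  have -> : t ^+ w i * x i 0 * (t ^+ w j * y j 0) =
            t ^+ w k * t ^+ (w i + w j - w k) * (x i 0 * y j 0).
    by rewrite -exprD subnKC // exprD; ring.
  ring.
apply: closure_orbit => //.
have [g gU ->] := proj2 (orbit_isomorphic A (c t)) iso.
exact: novikov_act.
Qed.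

End InitialForm.

(** * Identities that persist in the closure *)

Section Invariants.
Variable K : fieldType.
Implicit Types (mu nu : structure K) (x y : 'cV[K]_3).

Definition rtrace mu y := \tr (rmul mu y).

Lemma rtraceE mu y : rtrace mu y = \sum_i product mu (basis_vec K i) y i 0.
Proof.
by apply: eq_bigr => i _; rewrite product_rmul -colE [RHS]mxE.
Qed.

(** Right multiplications of conjugate structures are conjugate matrices. *)
Lemma rtrace_act (g : 'M[K]_3) mu y : g \in unitmx ->
  rtrace (act g mu) y = rtrace mu (invmx g *m y).
Proof.
move=> gU; suff E : rmul (act g mu) y =
    g *m (rmul mu (invmx g *m y) *m invmx g).
  by rewrite /rtrace E mxtrace_mulC mulmxKV.
apply/matrixP=> k i.
have E (M : 'M[K]_3) : M k i = (M *m basis_vec K i) k 0.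
  by rewrite -colE mxE.
by rewrite [LHS]E [RHS]E -product_rmul product_act product_rmul !mulmxA.
Qed.

(** Removing the scalar part of each right multiplication is equivariant; in
    E_1, E_2, E_6, E_5(-1) and E_5(-1/2) what remains is a 3-tensor from which
    one of its arguments splits off. *)
Definition tracefree mu x y := product mu x y - (rtrace mu y / 3) *: x.

Lemma tracefree_act (g : 'M[K]_3) mu x y : g \in unitmx ->
  tracefree (act g mu) x y =
  g *m tracefree mu (invmx g *m x) (invmx g *m y).
Proof.
move=> gU; rewrite /tracefree rtrace_act // product_act mulmxBr.
by rewrite -scalemxAr mulKVmx.
Qed.

Definition bracket mu x y := product mu x y - product mu y x.

Lemma bracket_act (g : 'M[K]_3) mu x y :
  bracket (act g mu) x y = g *m bracket mu (invmx g *m x) (invmx g *m y).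
Proof. by rewrite /bracket !product_act -mulmxBr. Qed.

Lemma polyfun_rtrace y : polyfun (fun mu => rtrace mu y).
Proof.
apply: represented_ext (fun mu => esym (rtraceE mu y)).
apply: represented_sum => i.
by apply: polyfun_product => j; apply: polyfun_cst.
Qed.

Lemma polyfun_tracefree x y k : polyfun (fun mu => tracefree mu x y k 0).
Proof.
apply: (@represented_ext _ _ _ _
  (fun mu => product mu x y k 0 - rtrace mu y * (3^-1 * x k 0))).
  apply: representedB.
    by apply: polyfun_product => j; apply: polyfun_cst.
  exact: representedM (polyfun_rtrace y) (polyfun_cst _).
by move=> mu; rewrite !mxE mulrA.
Qed.

Lemma polyfun_bracket x (Y : structure K -> 'cV[K]_3) k :
  (forall i, polyfun (fun mu => Y mu i 0)) ->
  polyfun (fun mu => bracket mu x (Y mu) k 0).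
Proof.
move=> polyY; apply: (@represented_ext _ _ _ _
  (fun mu => product mu x (Y mu) k 0 - product mu (Y mu) x k 0)).
  by apply: representedB; apply: polyfun_product => // j; apply: polyfun_cst.
by move=> mu; rewrite !mxE.
Qed.

Variable A : structure K.

Lemma closure_tracefree mu x1 y1 k1 x2 y2 k2 x3 y3 k3 x4 y4 k4 :
  (forall nu, orbit A nu ->
     tracefree nu x1 y1 k1 0 * tracefree nu x2 y2 k2 0 =
     tracefree nu x3 y3 k3 0 * tracefree nu x4 y4 k4 0) ->
  zariski_closure (orbit A) mu ->
  tracefree mu x1 y1 k1 0 * tracefree mu x2 y2 k2 0 =
  tracefree mu x3 y3 k3 0 * tracefree mu x4 y4 k4 0.
Proof.
move=> idA clmu; apply/eqP; rewrite -subr_eq0; apply/eqP.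
apply: (closure_polyfun _ _ clmu (F := fun mu =>
  tracefree mu x1 y1 k1 0 * tracefree mu x2 y2 k2 0 -
  tracefree mu x3 y3 k3 0 * tracefree mu x4 y4 k4 0)).
  by apply: representedB; apply: representedM; apply: polyfun_tracefree.
by move=> nu /idA->; rewrite subrr.
Qed.

(** The factorisation is a property of the whole orbit, since the action moves
    [f] and [C] separately; only the minors that it annihilates are polynomial
    conditions, and so pass to the closure.  Likewise for the next two lemmas,
    with the other two ways to single out one argument of a 3-tensor. *)
Lemma closure_left_rank1 mu x x' y y' k k' (f : 'cV[K]_3 -> K) C :
  (forall x y, tracefree A x y = f x *: C y) ->
  zariski_closure (orbit A) mu ->
  tracefree mu x y k 0 * tracefree mu x' y' k' 0 =
  tracefree mu x' y k 0 * tracefree mu x y' k' 0.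
Proof.
move=> fC; apply: closure_tracefree => _ [g gU ->].
by rewrite !tracefree_act // !fC -!scalemxAr !cV_scaleE; ring.
Qed.

Lemma closure_right_rank1 mu x x' y y' k k' (f : 'cV[K]_3 -> K) C :
  (forall x y, tracefree A x y = f y *: C x) ->
  zariski_closure (orbit A) mu ->
  tracefree mu x y k 0 * tracefree mu x' y' k' 0 =
  tracefree mu x y' k 0 * tracefree mu x' y k' 0.
Proof.
move=> fC; apply: closure_tracefree => _ [g gU ->].
by rewrite !tracefree_act // !fC -!scalemxAr !cV_scaleE; ring.
Qed.

Lemma closure_image_rank1 mu x x' y y' k k' (f : 'cV[K]_3 -> 'cV[K]_3 -> K) u :
  (forall x y, tracefree A x y = f x y *: u) ->
  zariski_closure (orbit A) mu ->
  tracefree mu x y k 0 * tracefree mu x' y' k' 0 =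
  tracefree mu x y k' 0 * tracefree mu x' y' k 0.
Proof.
move=> fC; apply: closure_tracefree => _ [g gU ->].
by rewrite !tracefree_act // !fC -!scalemxAr !cV_scaleE; ring.
Qed.

(** If ad_x has eigenvalues 0, f(x) and l f(x), and tr R_x = c f(x), this is
    c^2 times the Cayley-Hamilton equation of ad_x applied to y.  Expressing f
    through tr R makes it a polynomial in the structure constants. *)
Definition ad_cubic mu (c l : K) x y :=
  c ^+ 2 *: bracket mu x (bracket mu x (bracket mu x y))
  - ((1 + l) * c * rtrace mu x) *: bracket mu x (bracket mu x y)
  + (l * rtrace mu x ^+ 2) *: bracket mu x y.

Lemma closure_ad_cubic mu c l x y : (forall x y, ad_cubic A c l x y = 0) ->
  zariski_closure (orbit A) mu -> ad_cubic mu c l x y = 0.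
Proof.
move=> cubA clmu; apply/colP=> k.
rewrite [RHS]mxE; apply: (closure_polyfun _ _ clmu
  (F := fun mu => ad_cubic mu c l x y k 0)); last first.
  move=> _ [g gU ->]; rewrite /ad_cubic rtrace_act // !bracket_act !mulKmx //.
  rewrite !scalemxAr -mulmxBr -mulmxDr.
  move: (cubA (invmx g *m x) (invmx g *m y)); rewrite /ad_cubic => ->.
  by rewrite mulmx0 mxE.
have p1 k' : polyfun (fun mu => bracket mu x y k' 0).
  by apply: polyfun_bracket => j; apply: polyfun_cst.
have p2 k' : polyfun (fun mu => bracket mu x (bracket mu x y) k' 0).
  exact: polyfun_bracket.
have p3 k' : polyfun
    (fun mu => bracket mu x (bracket mu x (bracket mu x y)) k' 0).
  exact: polyfun_bracket.
have r := polyfun_rtrace x.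
apply: (@represented_ext _ _ _ _ (fun mu =>
  c ^+ 2 * bracket mu x (bracket mu x (bracket mu x y)) k 0
  - ((1 + l) * c * rtrace mu x) * bracket mu x (bracket mu x y) k 0
  + (l * rtrace mu x ^+ 2) * bracket mu x y k 0)); last first.
  by move=> nu; rewrite !mxE.
apply: representedD; first apply: representedB.
- exact: representedM (polyfun_cst _) (p3 k).
- by apply: representedM (p2 k); apply: representedM r; apply: polyfun_cst.
- apply: representedM (p1 k); apply: representedM; first exact: polyfun_cst.
  exact: representedX.
Qed.

End Invariants.

(** * The algebras of the two lists *)

Section Tables.
Variable K : fieldType.
Hypotheses (K2 : 2 != 0 :> K) (K3 : 3 != 0 :> K).
Implicit Types x y : 'cV[K]_3.

Lemma product_E1 l a x y : product (E1 l a) x y =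
  col3 (a * x i0 0 * y i0 0)
       ((a + 1) * x i0 0 * y i1 0 + a * x i1 0 * y i0 0)
       ((a + l) * x i0 0 * y i2 0 + a * x i2 0 * y i0 0).
Proof. by apply/colP; apply: ord3_ind; rewrite col3E; table_tac. Qed.

Lemma product_E2 l x y : product (E2 l) x y =
  col3 (- x i0 0 * y i0 0)
       (x i0 0 * y i0 0 - x i1 0 * y i0 0)
       ((l - 1) * x i0 0 * y i2 0 - x i2 0 * y i0 0).
Proof. by apply/colP; apply: ord3_ind; rewrite col3E; table_tac. Qed.

Lemma product_E3 x y : product E3 x y =
  col3 (- 2^-1 * x i0 0 * y i0 0)
       (2^-1 * x i0 0 * y i1 0 + x i0 0 * y i2 0
        - 2^-1 * x i1 0 * y i0 0 + x i2 0 * y i0 0)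
       (x i0 0 * y i0 0 - 2^-1 * x i2 0 * y i0 0).
Proof. by apply/colP; apply: ord3_ind; rewrite col3E; table_tac. Qed.

Lemma product_E4 x y : product E4 x y =
  col3 (- x i0 0 * y i0 0)
       (x i0 0 * y i0 0 - x i1 0 * y i0 0 + x i2 0 * y i2 0)
       (- 2^-1 * x i0 0 * y i2 0 - x i2 0 * y i0 0).
Proof. by apply/colP; apply: ord3_ind; rewrite col3E; table_tac. Qed.

Lemma product_E5 b x y : product (E5 b) x y =
  col3 (b * x i0 0 * y i0 0)
       ((b + 1) * x i0 0 * y i1 0 + b * x i1 0 * y i0 0 + x i2 0 * y i2 0)
       ((b + 2^-1) * x i0 0 * y i2 0 + b * x i2 0 * y i0 0).
Proof. by apply/colP; apply: ord3_ind; rewrite col3E; table_tac. Qed.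

Lemma product_E6 x y : product E6 x y =
  col3 (- 2^-1 * x i0 0 * y i0 0)
       (2^-1 * x i0 0 * y i1 0 + x i0 0 * y i2 0
        - 2^-1 * x i1 0 * y i0 0 + x i2 0 * y i0 0)
       (- 2^-1 * x i2 0 * y i0 0).
Proof. by apply/colP; apply: ord3_ind; rewrite col3E; table_tac. Qed.

Lemma product_B1 x y : product B1 x y =
  col3 (x i0 0 * y i0 0)
       (x i0 0 * y i1 0 + x i1 0 * y i0 0)
       (x i0 0 * y i1 0 + x i0 0 * y i2 0 + x i2 0 * y i0 0).
Proof. by apply/colP; apply: ord3_ind; rewrite col3E; table_tac. Qed.

Lemma product_B2 x y : product B2 x y =
  col3 (x i0 0 * y i0 0)
       (x i0 0 * y i1 0 + x i1 0 * y i0 0)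
       (x i0 0 * y i1 0 + x i0 0 * y i2 0 + x i2 0 * y i0 0
        + x i1 0 * y i1 0).
Proof. by apply/colP; apply: ord3_ind; rewrite col3E; table_tac. Qed.

Lemma product_B3 x y : product B3 x y =
  col3 0 0 (2^-1 * x i0 0 * y i1 0 - 2^-1 * x i1 0 * y i0 0 + x i1 0 * y i1 0).
Proof. by apply/colP; apply: ord3_ind; rewrite col3E; table_tac. Qed.

Lemma product_B4 a x y : product (B4 a) x y =
  col3 (x i1 0 * y i1 0) 0 (a * x i0 0 * y i1 0 + (a - 1) * x i1 0 * y i0 0).
Proof. by apply/colP; apply: ord3_ind; rewrite col3E; table_tac. Qed.

Lemma product_B5 b x y : product (B5 b) x y =
  col3 0 0 (b * x i0 0 * y i1 0 + (b - 1) * x i1 0 * y i0 0).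
Proof. by apply/colP; apply: ord3_ind; rewrite col3E; table_tac. Qed.

Definition product_tables := (product_E1, product_E2, product_E3, product_E4,
  product_E5, product_E6, product_B1, product_B2, product_B3, product_B4,
  product_B5).

Ltac rtrace_tac :=
  rewrite rtraceE sum3E !product_tables !col3E !basis_vecE !eqE /=; field.

Lemma rtrace_E1 l a y : rtrace (E1 l a) y = 3 * a * y i0 0.
Proof. by rtrace_tac. Qed.
Lemma rtrace_E2 l y : rtrace (E2 l) y = -3 * y i0 0.
Proof. by rtrace_tac. Qed.
Lemma rtrace_E3 y : rtrace E3 y = - 3 / 2 * y i0 0.
Proof. by rtrace_tac. Qed.
Lemma rtrace_E4 y : rtrace E4 y = - 3 * y i0 0.
Proof. by rtrace_tac. Qed.
Lemma rtrace_E5 b y : rtrace (E5 b) y = 3 * b * y i0 0.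
Proof. by rtrace_tac. Qed.
Lemma rtrace_E6 y : rtrace E6 y = - 3 / 2 * y i0 0.
Proof. by rtrace_tac. Qed.
Lemma rtrace_B1 y : rtrace B1 y = 3 * y i0 0.
Proof. by rtrace_tac. Qed.
Lemma rtrace_B2 y : rtrace B2 y = 3 * y i0 0.
Proof. by rtrace_tac. Qed.
Lemma rtrace_B3 y : rtrace B3 y = 0.
Proof. by rtrace_tac. Qed.
Lemma rtrace_B4 a y : rtrace (B4 a) y = 0.
Proof. by rtrace_tac. Qed.
Lemma rtrace_B5 b y : rtrace (B5 b) y = 0.
Proof. by rtrace_tac. Qed.

Definition rtrace_tables := (rtrace_E1, rtrace_E2, rtrace_E3, rtrace_E4,
  rtrace_E5, rtrace_E6, rtrace_B1, rtrace_B2, rtrace_B3, rtrace_B4,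
  rtrace_B5).

Ltac tracefree_tac :=
  apply/colP; apply: ord3_ind;
  rewrite /tracefree !product_tables !rtrace_tables cV_subE !cV_scaleE !col3E;
  field; rewrite ?K2 ?K3.

Lemma tracefree_E1 l a x y : tracefree (E1 l a) x y =
  x i0 0 *: col3 0 ((a + 1) * y i1 0) ((a + l) * y i2 0).
Proof. by tracefree_tac. Qed.

Lemma tracefree_E1_N1 l x y : tracefree (E1 l (-1)) x y =
  y i2 0 *: col3 0 0 ((l - 1) * x i0 0).
Proof. by tracefree_tac. Qed.

Lemma tracefree_E1_Nl l x y : tracefree (E1 l (- l)) x y =
  y i1 0 *: col3 0 ((1 - l) * x i0 0) 0.
Proof. by tracefree_tac. Qed.

Lemma tracefree_E2 l x y : tracefree (E2 l) x y =
  x i0 0 *: col3 0 (y i0 0) ((l - 1) * y i2 0).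
Proof. by tracefree_tac. Qed.

Lemma tracefree_E5_N1 x y : tracefree (E5 (-1)) x y =
  y i2 0 *: col3 0 (x i2 0) (- 2^-1 * x i0 0).
Proof. by tracefree_tac. Qed.

Lemma tracefree_E5_Nhalf x y : tracefree (E5 (- (1 / 2))) x y =
  (2^-1 * x i0 0 * y i1 0 + x i2 0 * y i2 0) *: col3 0 1 0.
Proof. by tracefree_tac. Qed.

Lemma tracefree_E6 x y : tracefree E6 x y =
  (2^-1 * x i0 0 * y i1 0 + x i0 0 * y i2 0 + x i2 0 * y i0 0) *: col3 0 1 0.
Proof. by tracefree_tac. Qed.

(** The Lie algebra r_{3,l}: [e1, e2] = e2 and [e1, e3] = l e3. *)
Definition lie_r3 l x y : 'cV[K]_3 :=
  col3 0 (x i0 0 * y i1 0 - x i1 0 * y i0 0)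
       (l * (x i0 0 * y i2 0 - x i2 0 * y i0 0)).

Ltac bracket_tac :=
  apply/colP; apply: ord3_ind;
  rewrite /bracket /lie_r3 !product_tables cV_subE !col3E;
  field; rewrite ?K2 ?K3.

Lemma bracket_E1 l a x y : bracket (E1 l a) x y = lie_r3 l x y.
Proof. by bracket_tac. Qed.
Lemma bracket_E2 l x y : bracket (E2 l) x y = lie_r3 l x y.
Proof. by bracket_tac. Qed.
Lemma bracket_E3 x y : bracket E3 x y = lie_r3 2^-1 x y.
Proof. by bracket_tac. Qed.
Lemma bracket_E4 x y : bracket E4 x y = lie_r3 2^-1 x y.
Proof. by bracket_tac. Qed.
Lemma bracket_E5 b x y : bracket (E5 b) x y = lie_r3 2^-1 x y.
Proof. by bracket_tac. Qed.
Lemma bracket_E6 x y : bracket E6 x y = lie_r3 2^-1 x y.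
Proof. by bracket_tac. Qed.

(** Commutators lie on the line of e_3, which is central for the commutator. *)
Lemma bracket_type_B B x y : type_B B -> bracket B x y = y -> y = 0.
Proof.
move=> tB; suff [d ->] : exists d,
    bracket B x y = col3 0 0 (d * (x i0 0 * y i1 0 - x i1 0 * y i0 0)).
  move=> yE; have y0 : y i0 0 = 0 by rewrite -yE col3E.
  have y1 : y i1 0 = 0 by rewrite -yE col3E.
  rewrite -yE y0 y1 !mulr0 subrr mulr0.
  by apply/colP; apply: ord3_ind; rewrite !mxE.
by case: tB => [||| a | b]; exists 1; apply/colP; apply: ord3_ind;
  rewrite /bracket !product_tables cV_subE !col3E; field.
Qed.

(** An isomorphism would carry the relation [e1, e2] = e2 of r_{3,l} into [B],
    where ad is nilpotent. *)
Lemma lie_r3_not_type_B A B l :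
  (forall x y, bracket A x y = lie_r3 l x y) ->
  type_B B -> ~ isomorphic A B.
Proof.
move=> AE tB [g gU E].
have fix2 : bracket A (basis_vec K i0) (basis_vec K i1) = basis_vec K i1.
  by rewrite AE; apply/colP; apply: ord3_ind;
    rewrite col3E !basis_vecE !eqE /=; ring.
have /(bracket_type_B tB) ge0 :
    bracket B (g *m basis_vec K i0) (g *m basis_vec K i1) = g *m basis_vec K i1.
  by rewrite /bracket -!E -mulmxBr -[in RHS]fix2.
have : basis_vec K i1 i1 0 = 0 :> K.
  by rewrite -(mulKmx gU (basis_vec _ _)) ge0 mulmx0 mxE.
by rewrite basis_vecE eqxx => /eqP; rewrite oner_eq0.
Qed.

Lemma ad_cubic_lie_r3 A c l x y :
  (forall x y, bracket A x y = lie_r3 l x y) ->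
  (forall y, rtrace A y = c * y i0 0) -> ad_cubic A c l x y = 0.
Proof.
move=> AE rE; rewrite /ad_cubic !AE rE.
by apply/colP; apply: ord3_ind; rewrite !mxE /=; ring.
Qed.

(** At x = e1 and y = e2 both algebras have [x, y] = e3, [x, e3] = 0 and
    tr R_x = 3, so that the cubic identity reads 9 l e3 = 0. *)
Lemma closure_not_B12 A (c l : K) : l != 0 ->
  (forall x y, bracket A x y = lie_r3 l x y) ->
  (forall y, rtrace A y = c * y i0 0) ->
  ~ zariski_closure (orbit A) B1 /\ ~ zariski_closure (orbit A) B2.
Proof.
move=> l0 AE rE.
have cubA x y := ad_cubic_lie_r3 x y AE rE.
suff H B : rtrace B (basis_vec K i0) = 3 ->
    (forall x y, bracket B x y =
       col3 0 0 (x i0 0 * y i1 0 - x i1 0 * y i0 0)) ->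
    ~ zariski_closure (orbit A) B.
  by split; apply: H => [|x y];
    rewrite ?rtrace_tables ?basis_vecE ?eqxx ?mulr1 //;
    apply/colP; apply: ord3_ind;
    rewrite /bracket !product_tables cV_subE !col3E; ring.
move=> r3 bE clB.
have /(congr1 (fun v : 'cV[K]_3 => v i2 0)) :=
  closure_ad_cubic (basis_vec K i0) (basis_vec K i1) cubA clB.
rewrite /ad_cubic !bE r3 !mxE !eqE /= => /eqP.
rewrite !(mulr0, mul0r, mulr1, subr0, add0r, oppr0).
by rewrite addr0 mulr1 mulf_eq0 expf_eq0 (negPf l0) (negPf K3).
Qed.

End Tables.

(** * Members of type B excluded by the minors *)

Section Minors.
Variable K : fieldType.
Hypotheses (K2 : 2 != 0 :> K) (K3 : 3 != 0 :> K).
Implicit Types (A : structure K) (x y : 'cV[K]_3).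

Ltac minor_tac :=
  rewrite /tracefree !rtrace_tables // !mul0r !scale0r !subr0;
  rewrite !product_tables // !col3E !basis_vecE !eqE /=.

(** The only nonzero products of B_3, B_4 and B_5 being among e_1 e_2, e_2 e_1
    and e_2 e_2, one minor decides each case.  The product of the coefficients
    of e_3 in e_1 e_2 and e_2 e_1 must equal that of those in e_1 e_1 and
    e_2 e_2, which is 0: this excludes B_3 and gives b (b - 1) = 0 for B_5.
    For B_4 the e_1-coordinate of e_2 e_2 is 1 and the minor reads a = 0. *)
Lemma left_rank1_type_B A (f : 'cV[K]_3 -> K) C :
  (forall x y, tracefree A x y = f x *: C y) ->
  [/\ ~ zariski_closure (orbit A) B3,
      forall a, zariski_closure (orbit A) (B4 a) -> a = 0 &
      forall b, zariski_closure (orbit A) (B5 b) -> b = 0 \/ b = 1].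
Proof.
move=> fC; split=> [|a|b].
- move=> /(closure_left_rank1 e1 e2 e2 e1 i2 i2 fC); minor_tac.
  rewrite !(mul0r, mulr0, addr0, subr0, mulr1, add0r, sub0r) => /eqP.
  by rewrite mulf_eq0 oppr_eq0 invr_eq0 (negPf K2).
- move=> /(closure_left_rank1 e1 e2 e2 e2 i2 i0 fC); minor_tac.
  by rewrite !(mul0r, mulr0, addr0, mulr1).
- move=> /(closure_left_rank1 e1 e2 e2 e1 i2 i2 fC); minor_tac.
  rewrite !(mul0r, mulr0, addr0, mulr1, add0r) => /eqP.
  by rewrite mulf_eq0 subr_eq0 => /orP[]/eqP; [left|right].
Qed.

(** Exchanging the arguments exchanges a and a - 1 in B_4. *)
Lemma right_rank1_type_B A (f : 'cV[K]_3 -> K) C :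
  (forall x y, tracefree A x y = f y *: C x) ->
  [/\ ~ zariski_closure (orbit A) B3,
      forall a, zariski_closure (orbit A) (B4 a) -> a = 1 &
      forall b, zariski_closure (orbit A) (B5 b) -> b = 0 \/ b = 1].
Proof.
move=> fC; split=> [|a|b].
- move=> /(closure_right_rank1 e1 e2 e2 e1 i2 i2 fC); minor_tac.
  rewrite !(mul0r, mulr0, addr0, subr0, mulr1, add0r, sub0r) => /eqP.
  by rewrite mulf_eq0 oppr_eq0 invr_eq0 (negPf K2).
- move=> /(closure_right_rank1 e2 e2 e1 e2 i2 i0 fC); minor_tac.
  rewrite !(mul0r, mulr0, addr0, mulr1, add0r) => /eqP.
  by rewrite subr_eq0 => /eqP.
- move=> /(closure_right_rank1 e1 e2 e2 e1 i2 i2 fC); minor_tac.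
  rewrite !(mul0r, mulr0, addr0, mulr1, add0r) => /eqP.
  by rewrite mulf_eq0 subr_eq0 => /orP[]/eqP; [left|right].
Qed.

(** The image of the product of B_4(a) contains e_1, a e_3 and (a - 1) e_3, and
    a, a - 1 are not both zero: it is not a line. *)
Lemma image_rank1_type_B A (f : 'cV[K]_3 -> 'cV[K]_3 -> K) u a :
  (forall x y, tracefree A x y = f x y *: u) ->
  ~ zariski_closure (orbit A) (B4 a).
Proof.
move=> fC clB.
have := closure_image_rank1 e1 e2 e2 e2 i2 i0 fC clB.
have := closure_image_rank1 e2 e2 e1 e2 i2 i0 fC clB.
minor_tac; rewrite !(mul0r, mulr0, addr0, mulr1, add0r) => + a0.
by rewrite a0 sub0r => /eqP; rewrite oppr_eq0 oner_eq0.
Qed.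

(** Exchange e_1 and e_2, and change the sign of e_3. *)
Lemma isomorphic_B5 b : isomorphic (@B5 K b) (B5 (1 - b)).
Proof.
exists (mat3 0 1 0 1 0 0 0 0 (-1)).
  apply: unitmx_mat3.
  rewrite !(mul0r, mulr0, mulr1, mul1r, subr0, sub0r, oppr0, opprK, addr0).
  by rewrite oner_eq0.
move=> x y; rewrite !mul_mat3 !product_B5 // !col3E.
by congr col3; ring.
Qed.

(** What all cases share: non-isomorphism and the exclusion of B_1 and B_2 come
    from the bracket and the trace.  In the last hypothesis B_5(b) may be listed
    through the isomorphic B_5(1 - b). *)
Lemma type_B_boundary_intro A (c l : K) (L : structure K -> Prop) :
  l != 0 ->
  (forall x y, bracket A x y = lie_r3 l x y) ->
  (forall y, rtrace A y = c * y i0 0) ->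
  (forall B, L B -> type_B B /\ zariski_closure (orbit A) B) ->
  (zariski_closure (orbit A) B3 -> L B3) ->
  (forall a, zariski_closure (orbit A) (B4 a) -> L (B4 a)) ->
  (forall b, zariski_closure (orbit A) (B5 b) -> L (B5 b) \/ L (B5 (1 - b))) ->
  type_B_boundary A L.
Proof.
move=> l0 AE rE LB L3 L4 L5 B tB; have notAB := lie_r3_not_type_B K2 AE.
have [clB1 clB2] := closure_not_B12 K3 l0 AE rE.
split=> [/in_boundaryE[clB _]|[B' /LB[tB' clB'] iso]]; last first.
  apply/in_boundaryE; split; last exact: notAB.
  exact: closure_isomorphic (isomorphic_sym iso) clB'.
case: tB clB => [/clB1 //|/clB2 //|/L3|a /L4|b /L5[]] LB';
  try by exists B3 + exists (B4 a) + exists (B5 b); rewrite //;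
    apply: isomorphic_refl.
by exists (B5 (1 - b)) => //; apply: isomorphic_B5.
Qed.

End Minors.

(** * Bases adapted to the degenerations *)

Section NormalForm.
Variable K : numFieldType.
Implicit Types A : structure K.

(** The coefficients [d], [m], [k] are those of B_4 (d = 1) and B_5 (d = 0),
    with k = m - 1.  All others are attached to terms of positive degree for
    the weights (2, 1, 3) and (3, 2, 5) of e_1, e_2, e_3; the term of [d] has
    degree 0 for the first and 1 for the second. *)
Definition adapted_form (d a b c p e m k : K) : structure K := of_table
  [:: [:: e *: e3; m *: e3 + a *: e1; 0];
      [:: k *: e3 + b *: e1; d *: e1 + a *: e2; c *: e3 + p *: e1];
      [:: 0; a *: e3; 0]].

Lemma product_adapted_form d a b c p e m k x y :
  product (adapted_form d a b c p e m k) x y =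
  col3 (a * x i0 0 * y i1 0 + b * x i1 0 * y i0 0 + d * x i1 0 * y i1 0
        + p * x i1 0 * y i2 0)
       (a * x i1 0 * y i1 0)
       (e * x i0 0 * y i0 0 + m * x i0 0 * y i1 0 + k * x i1 0 * y i0 0
        + c * x i1 0 * y i2 0 + a * x i2 0 * y i1 0).
Proof. by apply/colP; apply: ord3_ind; rewrite col3E; table_tac. Qed.

Definition weight (a b c : nat) (i : 'I_3) : nat := nth 0%N [:: a; b; c] i.

Lemma closure_orbit_trans A A' B : isomorphic A A' ->
  zariski_closure (orbit A') B -> zariski_closure (orbit A) B.
Proof.
move=> iso [novB clB]; split=> // q q0; apply: clB => nu /orbit_isomorphic iso'.
by apply/q0/orbit_isomorphic/(isomorphic_trans iso iso').
Qed.

Lemma isomorphic_novikov A A' : isomorphic A A' -> novikov A -> novikov A'.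
Proof. by case/orbit_isomorphic=> g gU -> /(novikov_act gU). Qed.

Ltac initial_form_tac :=
  apply/ffunP; do 2 case; do 3 apply: ord3_ind;
  rewrite !ffunE /= ?mxE ?eqE /=; ring.

Ltac weight_tac :=
  do 3 apply: ord3_ind; rewrite // => /negP[]; apply/eqP;
  rewrite ffunE /= ?mxE ?eqE /=; ring.

Lemma adapted_form_closure_B4 A a b c p e m :
  novikov A -> isomorphic A (adapted_form 1 a b c p e m (m - 1)) ->
  zariski_closure (orbit A) (B4 m).
Proof.
move=> novA iso; apply: (closure_orbit_trans iso).
have B4E : B4 m = [ffun u : 'I_3 * 'I_3 * 'I_3 =>
    if (weight 2 1 3 u.1.1 + weight 2 1 3 u.1.2 == weight 2 1 3 u.2)%N
    then adapted_form 1 a b c p e m (m - 1) u else 0] by initial_form_tac.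
rewrite B4E; apply: closure_initial_form.
- by weight_tac.
- exact: isomorphic_novikov iso novA.
- by rewrite -B4E; apply: novikov_B4.
Qed.

Lemma adapted_form_closure_B5 A d a b c p e m :
  novikov A -> isomorphic A (adapted_form d a b c p e m (m - 1)) ->
  zariski_closure (orbit A) (B5 m).
Proof.
move=> novA iso; apply: (closure_orbit_trans iso).
have B5E : B5 m = [ffun u : 'I_3 * 'I_3 * 'I_3 =>
    if (weight 3 2 5 u.1.1 + weight 3 2 5 u.1.2 == weight 3 2 5 u.2)%N
    then adapted_form d a b c p e m (m - 1) u else 0] by initial_form_tac.
rewrite B5E; apply: closure_initial_form.
- by weight_tac.
- exact: isomorphic_novikov iso novA.
- by rewrite -B5E; apply: novikov_B5.
Qed.

(** The columns of [g] are the vectors of [A] that multiply as the basis of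
    [B]. *)
Lemma isomorphic_frame A B g : g \in unitmx ->
  (forall x y, product A (g *m x) (g *m y) = g *m product B x y) ->
  isomorphic A B.
Proof. by move=> gU E; apply: isomorphic_sym; exists g. Qed.

Let K2 : 2 != 0 :> K. Proof. by rewrite pnatr_eq0. Qed.

Ltac frame_tac := move=> x y;
  rewrite !mul_mat3 product_adapted_form ?product_tables // !col3E;
  congr col3; field.

(** Write the product of [E1 l a] as a f(y) x + f(x) C y, where f is the first
    coordinate and C = diag(0, a + 1, a + l).  As C has distinct eigenvalues,
    v = (1, 1, 1) is cyclic; the basis (C v, v, - C^2 v) gives e_2 e_2 = e_1 and
    e_2 e_1 = - e_3 up to terms of positive degree, because f C = 0 and f v = 1.
    The remaining coefficients are those of the characteristic polynomial of
    C. *)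
Lemma E1_adapted l a : l != 1 -> a != -1 -> a != - l ->
  isomorphic (E1 l a) (adapted_form 1 a 0 (a + 1 + (a + l)) ((a + 1) * (a + l))
                               0 0 (0 - 1)).
Proof.
move=> l1 a1 al.
apply: (@isomorphic_frame _ _
  (mat3 0 1 0 (a + 1) 1 (- (a + 1) ^+ 2) (a + l) 1 (- (a + l) ^+ 2))).
  apply: unitmx_mat3.
  have -> : 0 * (1 * - (a + l) ^+ 2 - - (a + 1) ^+ 2 * 1) -
    1 * ((a + 1) * - (a + l) ^+ 2 - - (a + 1) ^+ 2 * (a + l)) +
    0 * ((a + 1) * 1 - 1 * (a + l)) = (a - -1) * (a - - l) * (l - 1) by ring.
  by rewrite !mulf_neq0 // subr_eq0.
by frame_tac.
Qed.

(** The basis (u, e_1, - C u) with u = (0, 1, 1), independent even when C is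
    singular. *)
Lemma E1_adapted0 l a : l != 1 ->
  isomorphic (E1 l a) (adapted_form 0 a 0 (a + 1 + (a + l)) ((a + 1) * (a + l))
                               0 0 (0 - 1)).
Proof.
move=> l1; apply: (@isomorphic_frame _ _
  (mat3 0 1 0 1 0 (- (a + 1)) 1 0 (- (a + l)))).
  apply: unitmx_mat3.
  rewrite !(mul0r, mulr0, mul1r, mulr1, subr0, sub0r, add0r, addr0).
  have -> : - (- (a + l) - - (a + 1)) = l - 1 by ring.
  by rewrite subr_eq0.
by frame_tac.
Qed.

(** As for [E1_adapted], with f(x) C y now for C e_1 = e_2, C e_2 = 0,
    C e_3 = (l - 1) e_3, and the cyclic vector (1, 0, 1). *)
Lemma E2_adapted l : l != 1 ->
  isomorphic (E2 l) (adapted_form 1 (-1) 0 (l - 1) 0 0 0 (0 - 1)).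
Proof.
move=> l1; apply: (@isomorphic_frame _ _
  (mat3 0 1 0 1 0 0 (l - 1) 1 (- (l - 1) ^+ 2))).
  apply: unitmx_mat3.
  have -> : 0 * (0 * - (l - 1) ^+ 2 - 0 * 1) -
    1 * (1 * - (l - 1) ^+ 2 - 0 * (l - 1)) +
    0 * (1 * 1 - 0 * (l - 1)) = (l - 1) ^+ 2 by ring.
  by rewrite expf_eq0 subr_eq0.
by frame_tac.
Qed.

(** In this and the next lemmas e_2 is sent to a vector v = (1, s, u) and, when
    the target is B_4, e_1 to the part of v v that is not proportional to v.
    The products with v on the left and on the right then both fall, up to
    terms of positive degree, on the second basis vector of the algebra, and s
    (or u) tunes their ratio to m : m - 1.  When the target is B_5, v v is
    proportional to v instead, and the ratio is tuned by the image of e_1. *)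
Lemma E3_adapted m : m != 0 ->
  isomorphic E3 (adapted_form 1 (- 2^-1) 0 2^-1 0 0 m (m - 1)).
Proof.
move=> m0; apply: (@isomorphic_frame _ _
  (mat3 0 1 0 (- 2 / m) (- 4 / m) m^-1 1 0 0)).
  apply: unitmx_mat3.
  rewrite !(mul0r, mulr0, mul1r, mulr1, subr0, sub0r, add0r, addr0) opprK.
  by rewrite invr_eq0.
by frame_tac.
Qed.

(** Here the ratio is a quadratic function of the coordinate [u] of v, whence
    the parametrisation of m by u. *)
Lemma E4_adapted (u : K) : u != 0 -> 1 + u ^+ 2 != 0 ->
  let m := u ^+ 2 / (1 + u ^+ 2) in
  isomorphic E4 (adapted_form 1 (-1) (- 2^-1) 0 0 (- 2^-1 * m) m (m - 1)).
Proof.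
move=> u0 v0 m; apply: (@isomorphic_frame _ _
  (mat3 0 1 0 (1 + u ^+ 2) 0 (- 2^-1 * (1 + u ^+ 2)) (- 2^-1 * u) u 0)).
  apply: unitmx_mat3.
  have -> : 0 * (0 * 0 - - 2^-1 * (1 + u ^+ 2) * u) -
    1 * ((1 + u ^+ 2) * 0 - - 2^-1 * (1 + u ^+ 2) * (- 2^-1 * u)) +
    0 * ((1 + u ^+ 2) * u - 0 * (- 2^-1 * u)) =
    2^-1 ^+ 2 * (1 + u ^+ 2) * u by ring.
  by rewrite !mulf_neq0 ?expf_neq0 ?invr_eq0.
by rewrite /m; frame_tac; rewrite ?K2 ?v0.
Qed.

Lemma E5_adapted b m : b + 1 != 0 -> b + 2^-1 != 0 -> m != 0 ->
  isomorphic (E5 b) (adapted_form 1 b (b + 2^-1) (b + 1) 0 ((b + 2^-1) * m)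
                             m (m - 1)).
Proof.
move=> b1 b2 m0; apply: (@isomorphic_frame _ _
  (mat3 0 1 0
        (- 2 * (b + 2^-1) / m) (- (1 + 2 * (b + 2^-1) / m) / (b + 1))
        ((b + 2^-1) / m)
        (b + 2^-1) 1 0)).
  apply: unitmx_mat3.
  rewrite !(mul0r, mulr0, mul1r, mulr1, subr0, sub0r, add0r, addr0) opprK.
  by rewrite !mulf_neq0 ?invr_eq0.
by frame_tac; rewrite ?K2 ?b1 ?b2 ?m0.
Qed.

(** For b = -1 the coordinate s no longer influences v v, and only m = 1 is
    reached. *)
Lemma E5_N1_adapted :
  isomorphic (E5 (-1)) (adapted_form 1 (-1) (- 2^-1) 0 0 (- 2^-1) 1 (1 - 1)).
Proof.
apply: (@isomorphic_frame _ _ (mat3 0 1 0 1 0 (- 2^-1) (- 2^-1) 1 0)).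
  apply: unitmx_mat3.
  rewrite !(mul0r, mulr0, mul1r, mulr1, subr0, sub0r, add0r, addr0) opprK.
  by rewrite mulf_neq0 ?oppr_eq0 ?invr_eq0.
by frame_tac; rewrite ?K2.
Qed.

Lemma E5_Nhalf_adapted m : m != 0 ->
  isomorphic (E5 (- (1 / 2))) (adapted_form 0 (- 2^-1) 0 2^-1 0 m m (m - 1)).
Proof.
move=> m0; apply: (@isomorphic_frame _ _
  (mat3 0 1 0 (- 2 / m) (- 2) m^-1 1 1 0)).
  apply: unitmx_mat3.
  rewrite !(mul0r, mulr0, mul1r, mulr1, subr0, sub0r, add0r, addr0) opprK.
  by rewrite invr_eq0.
by frame_tac; rewrite ?K2 ?m0.
Qed.

Lemma E6_adapted m : m != 0 ->
  isomorphic E6 (adapted_form 0 (- 2^-1) 0 2^-1 0 0 m (m - 1)).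
Proof.
move=> m0; apply: (@isomorphic_frame _ _
  (mat3 0 1 0 (- 2 / m) 0 m^-1 1 0 0)).
  apply: unitmx_mat3.
  rewrite !(mul0r, mulr0, mul1r, mulr1, subr0, sub0r, add0r, addr0) opprK.
  by rewrite invr_eq0.
by frame_tac; rewrite ?K2 ?m0.
Qed.

(** The structures B_4(m) form a line; likewise the B_5(m). *)
Lemma closure_B4_all (S : structure K -> Prop) (bad : seq K) :
  (forall m, m \notin bad -> zariski_closure S (B4 m)) ->
  forall m, zariski_closure S (B4 m).
Proof.
move=> clB m; have E t : B4 t = [ffun u => B4 0 u + t * (B4 1 u - B4 0 u)].
  by initial_form_tac.
rewrite E; apply: (closure_line (bad := bad)) => [t /clB|]; rewrite -E //.
exact: novikov_B4.
Qed.

Lemma closure_B5_all (S : structure K -> Prop) (bad : seq K) :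
  (forall m, m \notin bad -> zariski_closure S (B5 m)) ->
  forall m, zariski_closure S (B5 m).
Proof.
move=> clB m; have E t : B5 t = [ffun u => B5 0 u + t * (B5 1 u - B5 0 u)].
  by initial_form_tac.
rewrite E; apply: (closure_line (bad := bad)) => [t /clB|]; rewrite -E //.
exact: novikov_B5.
Qed.

(** Adding e_2 e_2 = e_3 to B_5(b) does not change its isomorphism class for
    b != 1/2, since a multiple of e_1 can be added to e_2; at b = 1/2 it gives
    B_3. *)
Lemma closure_B5_B3 A :
  (forall m, zariski_closure (orbit A) (B5 m)) -> zariski_closure (orbit A) B3.
Proof.
move=> clB.
pose D t : structure K := [ffun u => B3 u + t * (B5 1 u - B5 0 u)].
have D0 : D 0 = B3 by apply/ffunP=> u; rewrite ffunE mul0r addr0.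
rewrite -D0; apply: (closure_line (bad := [:: 0])); last first.
  by rewrite -/(D 0) D0; apply: novikov_B3.
move=> t; rewrite inE => t0; rewrite -/(D t).
apply: closure_isomorphic (clB (t + 2^-1)); apply: isomorphic_sym.
have DE : D t = of_table [:: [:: 0; (t + 2^-1) *: e3; 0];
                             [:: (t - 2^-1) *: e3; e3; 0]; [:: 0; 0; 0]].
  by apply/ffunP=> -[[i j] k]; rewrite !ffunE; move: i j k;
    do 3 apply: ord3_ind; rewrite /= !mxE ?eqE /=; field.
apply: isomorphic_sym; apply: (@isomorphic_frame _ _
  (mat3 1 (2 * t)^-1 0 0 1 0 0 0 1)).
  apply: unitmx_mat3.
  by rewrite !(mul0r, mulr0, mul1r, mulr1, subr0, addr0) oner_eq0.
have pD x y : product (D t) x y = col3 0 0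
  ((t + 2^-1) * x i0 0 * y i1 0 + (t - 2^-1) * x i1 0 * y i0 0
   + x i1 0 * y i1 0).
  by rewrite DE; apply/colP; apply: ord3_ind; rewrite col3E; table_tac.
move=> x y; rewrite !mul_mat3 pD product_B5 !col3E.
by congr col3; field; rewrite ?t0.
Qed.

Lemma adapted_form_closure_all A (bad : seq K) : novikov A ->
  (forall m, m \notin bad -> exists a b c p e,
     isomorphic A (adapted_form 1 a b c p e m (m - 1))) ->
  forall m, zariski_closure (orbit A) (B4 m) /\
            zariski_closure (orbit A) (B5 m).
Proof.
move=> novA isoA m; split; move: m.
  apply: (closure_B4_all (bad := bad)) => m /isoA[a [b [c [p [e iso]]]]].
  exact: adapted_form_closure_B4 novA iso.
apply: (closure_B5_all (bad := bad)) => m /isoA[a [b [c [p [e iso]]]]].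
exact: adapted_form_closure_B5 novA iso.
Qed.

End NormalForm.

(** * Boundaries *)

Section Boundaries.
Variable K : numClosedFieldType.

Let K2 : 2 != 0 :> K. Proof. by rewrite pnatr_eq0. Qed.
Let K3 : 3 != 0 :> K. Proof. by rewrite pnatr_eq0. Qed.

Let half_neq0 : 2^-1 != 0 :> K. Proof. by rewrite invr_eq0. Qed.

Lemma boundary_all (A : structure K) c :
  (forall x y, bracket A x y = lie_r3 2^-1 x y) ->
  (forall y, rtrace A y = c * y i0 0) ->
  (forall m, zariski_closure (orbit A) (B4 m)) ->
  (forall m, zariski_closure (orbit A) (B5 m)) ->
  type_B_boundary A
    (fun B => B = B3 \/ (exists mu, B = B4 mu) \/ (exists nu, B = B5 nu)).
Proof.
move=> AE rE clB4 clB5.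
apply: (type_B_boundary_intro K2 K3 half_neq0 AE rE) => [B|_|a _|b _].
- move=> [->|[[m ->]|[n ->]]]; split=> //; try by constructor.
  exact: closure_B5_B3.
- by left.
- by right; left; exists a.
- by left; right; right; exists b.
Qed.

Lemma boundary_B3_B5 (A : structure K) c f u :
  (forall x y, bracket A x y = lie_r3 2^-1 x y) ->
  (forall y, rtrace A y = c * y i0 0) ->
  (forall x y, tracefree A x y = f x y *: u) ->
  (forall m, zariski_closure (orbit A) (B5 m)) ->
  type_B_boundary A (fun B => B = B3 \/ (exists nu, B = B5 nu)).
Proof.
move=> AE rE tA clB5.
apply: (type_B_boundary_intro K2 K3 half_neq0 AE rE) => [B|_|a|b _].
- move=> [->|[n ->]]; split=> //; try by constructor.
  exact: closure_B5_B3.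
- by left.
- by move/(image_rank1_type_B tA).
- by left; right; exists b.
Qed.

Lemma boundary_left (A : structure K) (c l : K) f C :
  l != 0 -> (forall x y, bracket A x y = lie_r3 l x y) ->
  (forall y, rtrace A y = c * y i0 0) ->
  (forall x y, tracefree A x y = f x *: C y) ->
  zariski_closure (orbit A) (B4 0) -> zariski_closure (orbit A) (B5 0) ->
  type_B_boundary A (fun B => B = B4 0 \/ B = B5 0).
Proof.
move=> l0 AE rE tA cl4 cl5.
have [not3 only4 only5] := left_rank1_type_B K2 tA.
apply: (type_B_boundary_intro K2 K3 l0 AE rE) => [B|/not3 //|a /only4->|b].
- by move=> [->|->]; split=> //; constructor.
- by left.
- by move=> /only5[]->; [left; right|right; right; rewrite subrr].
Qed.

Lemma boundary_left_right (A : structure K) (c l : K) f C f' C' :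
  l != 0 -> (forall x y, bracket A x y = lie_r3 l x y) ->
  (forall y, rtrace A y = c * y i0 0) ->
  (forall x y, tracefree A x y = f x *: C y) ->
  (forall x y, tracefree A x y = f' y *: C' x) ->
  zariski_closure (orbit A) (B5 0) ->
  type_B_boundary A (fun B => B = B5 0).
Proof.
move=> l0 AE rE tA tA' cl5.
have [not3 only4 only5] := left_rank1_type_B K2 tA.
have [_ only4' _] := right_rank1_type_B K2 tA'.
apply: (type_B_boundary_intro K2 K3 l0 AE rE) => [B|/not3 //|a cl4|b].
- by move=> ->; split=> //; constructor.
- by have /eqP := only4' _ cl4; rewrite (only4 _ cl4) eq_sym oner_eq0.
- by move=> /only5[]->; [left|right; rewrite subrr].
Qed.

Lemma boundary_right (A : structure K) (c l : K) f C :
  l != 0 -> (forall x y, bracket A x y = lie_r3 l x y) ->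
  (forall y, rtrace A y = c * y i0 0) ->
  (forall x y, tracefree A x y = f y *: C x) ->
  zariski_closure (orbit A) (B4 1) -> zariski_closure (orbit A) (B5 1) ->
  type_B_boundary A (fun B => B = B4 1 \/ B = B5 0).
Proof.
move=> l0 AE rE tA cl4 cl5.
have [not3 only4 only5] := right_rank1_type_B K2 tA.
apply: (type_B_boundary_intro K2 K3 l0 AE rE) => [B|/not3 //|a /only4->|b].
- move=> [->|->]; split=> //; try by constructor.
  apply: closure_isomorphic cl5.
  by have := isomorphic_B5 (1 : K); rewrite subrr.
- by left.
- by move=> /only5[]->; [left; right|right; right; rewrite subrr].
Qed.

Lemma E3_closure (m : K) :
  zariski_closure (orbit (@E3 K)) (B4 m) /\
  zariski_closure (orbit (@E3 K)) (B5 m).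
Proof.
apply: (adapted_form_closure_all (bad := [:: 0]) (novikov_E3 K2)) => n.
by rewrite inE => n0; do 5 eexists; apply: E3_adapted.
Qed.

Lemma E4_closure (m : K) :
  zariski_closure (orbit (@E4 K)) (B4 m) /\
  zariski_closure (orbit (@E4 K)) (B5 m).
Proof.
apply: (adapted_form_closure_all (bad := [:: 0; 1]) (novikov_E4 K2)) => n.
rewrite !inE negb_or => /andP[n0 n1].
have n1' : 1 - n != 0 by rewrite subr_eq0 eq_sym.
(* u solves u^2 / (1 + u^2) = n *)
have u2 := sqrtCK (n / (1 - n)); set u := sqrtC _ in u2.
have u0 : u != 0 by rewrite sqrtC_eq0 mulf_neq0 ?invr_eq0.
have uE : 1 + u ^+ 2 = (1 - n)^-1 by rewrite u2; field.
have v0 : 1 + u ^+ 2 != 0 by rewrite uE invr_eq0.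
have -> : n = u ^+ 2 / (1 + u ^+ 2) by rewrite uE u2; field.
by do 5 eexists; apply: E4_adapted.
Qed.

Lemma E5_closure (b m : K) : b != - (1 / 2) -> b != -1 ->
  zariski_closure (orbit (E5 b)) (B4 m) /\
  zariski_closure (orbit (E5 b)) (B5 m).
Proof.
rewrite div1r -subr_eq0 opprK => b2; rewrite -subr_eq0 opprK => b1.
apply: (adapted_form_closure_all (bad := [:: 0]) (novikov_E5 b K2)) => n.
by rewrite inE => n0; do 5 eexists; apply: E5_adapted.
Qed.

Lemma E1_closure_B5 (l a : K) : l != 1 ->
  zariski_closure (orbit (E1 l a)) (B5 0).
Proof.
move=> l1.
exact: adapted_form_closure_B5 (novikov_E1 l a) (E1_adapted0 a l1).
Qed.

(** Exchange e_2 and e_3, and rescale e_1. *)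
Lemma isomorphic_E1_Nl (l : K) : l != 0 ->
  isomorphic (E1 l (- l)) (E1 (1 / l) (-1)).
Proof.
move=> l0; exists (mat3 l 0 0 0 0 1 0 1 0).
  apply: unitmx_mat3.
  by rewrite !(mul0r, mulr0, mulr1, addr0, subr0, sub0r) mulrN1 oppr_eq0.
move=> x y; rewrite !product_E1 // !mul_mat3 !col3E.
by congr col3; field.
Qed.

End Boundaries.

Theorem proposition4p9 (R : realType) :
  (forall lambda alpha : R[i], lambda != 0 -> lambda != 1 ->
     alpha != -1 -> alpha != - lambda ->
     type_B_boundary (E1 lambda alpha) (fun B => B = B4 0 \/ B = B5 0)) /\
  (forall lambda : R[i], lambda != 0 -> lambda != 1 ->
     type_B_boundary (E1 lambda (-1)) (fun B => B = B5 0)) /\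
  (forall lambda : R[i], lambda != 0 -> lambda != 1 ->
     isomorphic (E1 lambda (- lambda)) (E1 (1 / lambda) (-1)) /\
     type_B_boundary (E1 lambda (- lambda)) (fun B => B = B5 0)) /\
  (forall lambda : R[i], lambda != 0 -> lambda != 1 ->
     type_B_boundary (E2 lambda) (fun B => B = B4 0 \/ B = B5 0)) /\
  type_B_boundary (@E3 R[i])
    (fun B => B = B3 \/ (exists mu, B = B4 mu) \/ (exists nu, B = B5 nu)) /\
  type_B_boundary (@E4 R[i])
    (fun B => B = B3 \/ (exists mu, B = B4 mu) \/ (exists nu, B = B5 nu)) /\
  (forall beta : R[i], beta != - (1 / 2) -> beta != -1 ->
     type_B_boundary (E5 beta)
       (fun B => B = B3 \/ (exists mu, B = B4 mu) \/ (exists nu, B = B5 nu))) /\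
  type_B_boundary (E5 (- (1 / 2) : R[i]))
    (fun B => B = B3 \/ (exists nu, B = B5 nu)) /\
  type_B_boundary (E5 (-1 : R[i])) (fun B => B = B4 1 \/ B = B5 0) /\
  type_B_boundary (@E6 R[i])
    (fun B => B = B3 \/ (exists nu, B = B5 nu)).
Proof.
have K2 : 2 != 0 :> R[i] by rewrite pnatr_eq0.
have K3 : 3 != 0 :> R[i] by rewrite pnatr_eq0.
split; first (move=> l a l0 l1 a1 al).
  apply: (boundary_left l0 (bracket_E1 l a) (rtrace_E1 l a)
           (tracefree_E1 K3 l a)).
    exact: adapted_form_closure_B4 (novikov_E1 l a) (E1_adapted l1 a1 al).
  exact: E1_closure_B5.
split; first (move=> l l0 l1).
  exact: (boundary_left_right l0 (bracket_E1 l _) (rtrace_E1 l _)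
    (tracefree_E1 K3 l _) (tracefree_E1_N1 K3 l) (E1_closure_B5 _ l1)).
split; first (move=> l l0 l1; split; first exact: isomorphic_E1_Nl).
  exact: (boundary_left_right l0 (bracket_E1 l _) (rtrace_E1 l _)
    (tracefree_E1 K3 l _) (tracefree_E1_Nl K3 l) (E1_closure_B5 _ l1)).
split; first (move=> l l0 l1).
  apply: (boundary_left l0 (bracket_E2 l) (rtrace_E2 l) (tracefree_E2 K3 l)).
    exact: adapted_form_closure_B4 (novikov_E2 l) (E2_adapted l1).
  exact: adapted_form_closure_B5 (novikov_E2 l) (E2_adapted l1).
split.
  by apply: (boundary_all (bracket_E3 K2) (rtrace_E3 K2)) => m;
    case: (E3_closure m).
split.
  by apply: (boundary_all (bracket_E4 K2) (rtrace_E4 K2)) => m;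
    case: (E4_closure m).
split; first (move=> b b1 b2).
  by apply: (boundary_all (bracket_E5 K2 b) (rtrace_E5 K2 b)) => m;
    case: (E5_closure m b1 b2).
split.
  apply: (boundary_B3_B5 (bracket_E5 K2 _) (rtrace_E5 K2 _)
           (tracefree_E5_Nhalf K2 K3)).
  apply: (closure_B5_all (bad := [:: 0])) => m; rewrite inE => m0.
  exact: adapted_form_closure_B5 (novikov_E5 _ K2) (E5_Nhalf_adapted m0).
split.
  have half0 : 2^-1 != 0 :> R[i] by rewrite invr_eq0.
  apply: (boundary_right half0 (bracket_E5 K2 _) (rtrace_E5 K2 _)
           (tracefree_E5_N1 K2 K3)).
    exact: adapted_form_closure_B4 (novikov_E5 _ K2) (E5_N1_adapted _).
  exact: adapted_form_closure_B5 (novikov_E5 _ K2) (E5_N1_adapted _).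
apply: (boundary_B3_B5 (bracket_E6 K2) (rtrace_E6 K2) (tracefree_E6 K2 K3)).
apply: (closure_B5_all (bad := [:: 0])) => m; rewrite inE => m0.
exact: adapted_form_closure_B5 (novikov_E6 K2) (E6_adapted m0).
Qed.
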